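(* There is an absolute constant $C>0$ such that the following holds. Let $H_0,H_1,\mu>0$, and let $f:\mathbb{R}^d\to\mathbb{R}$ be $(H_0,H_1)$-smooth (not necessarily convex) and satisfy the Polyak–Łojasiewicz inequality $\|\nabla f(x)\|^2\ge2\mu(f(x)-f^* )$ for all $x\in\mathbb{R}^d$. Let $\theta\in(0,3/4]$, and let $(x^k)_{k\ge0}$ be generated by gradient descent with the warm-up step size $\eta_k=\theta\min\left\{\frac1{H_0},\frac1{3H_1F_k}\right\}$, where $F_k=f(x^k)-f^*$. Then $F_{k+1}\le F_k-\eta_k\mu F_k$ for all $k\ge0$, and consequently, for every $\varepsilon\in(0,F_0)$ and every integer $$N\ge C\left(\frac{H_0}{\theta\mu}\log\left(\frac{F_0}{\varepsilon}\right)+\frac{H_1F_0}{\theta\mu}\right)$$ one has $f(x^N)-f^*\le\varepsilon$.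
   Context: $f$ is differentiable on $\mathbb{R}^d$ and $f^*=\min_xf(x)$; $\|\cdot\|$ is the Euclidean norm. $(H_0,H_1)$-smoothness: for all $x,y\in\mathbb{R}^d$ with $\|y-x\|\le1/\sqrt{H_1}$, $\|\nabla f(y)-\nabla f(x)\|\le\big(H_0+H_1[f(x)-f^*]\big)\|y-x\|$. Gradient descent: $x^0\in\mathbb{R}^d$ is given and $x^{k+1}=x^k-\eta_k\nabla f(x^k)$ for $k\ge0$, with the convention $\frac1{3H_1F_k}=+\infty$ (so $\eta_k=\theta/H_0$) when $F_k=0$. *)

(* Defs.v *)
From HB Require Import structures.
From mathcomp Require Import all_boot all_order all_algebra.
From mathcomp Require Import all_classical all_reals all_analysis.

Set Implicit Arguments.
Unset Strict Implicit.
Unset Printing Implicit Defensive.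

Import Order.TTheory GRing.Theory Num.Theory.
Import numFieldNormedType.Exports.

Local Open Scope ring_scope.

(* The canonical norm `|v| on 'rV[R]_d is the sup norm, so the Euclidean norm
   is defined explicitly. The two norms are equivalent, hence
   differentiability does not depend on which one is used. *)
Definition enorm (R : realType) (d : nat) (v : 'rV[R]_d) : R :=
  Num.sqrt (\sum_(i < d) (v 0 i) ^+ 2).

Definition gradient (R : realType) (d : nat) (f : 'rV[R]_d -> R)
    (x : 'rV[R]_d) : 'rV[R]_d :=
  \row_(i < d) 'D_(delta_mx 0 i) f x.

Definition is_min (R : realType) (d : nat) (f : 'rV[R]_d -> R)
    (fstar : R) : Prop :=
  (exists xstar, f xstar = fstar) /\ (forall x, fstar <= f x).

Definition smooth (R : realType) (d : nat) (f : 'rV[R]_d -> R)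
    (fstar H0 H1 : R) : Prop :=
  forall x y : 'rV[R]_d, enorm (y - x) <= 1 / Num.sqrt H1 ->
    enorm (gradient f y - gradient f x)
      <= (H0 + H1 * (f x - fstar)) * enorm (y - x).

Definition polyak_lojasiewicz (R : realType) (d : nat) (f : 'rV[R]_d -> R)
    (fstar mu : R) : Prop :=
  forall x : 'rV[R]_d,
    2 * mu * (f x - fstar) <= enorm (gradient f x) ^+ 2.

(* The case F = 0 is the convention 1 / (3 * H1 * F) = +oo; it must be
   separate because x / 0 is 0 here. *)
Definition warmup_step (R : realType) (H0 H1 theta F : R) : R :=
  if F == 0 then theta / H0
  else theta * Num.min (1 / H0) (1 / (3 * H1 * F)).

Definition gradient_descent (R : realType) (d : nat) (f : 'rV[R]_d -> R)
    (eta : nat -> R) (x : nat -> 'rV[R]_d) : Prop :=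
  forall k : nat, x k.+1 = x k - eta k *: gradient f (x k).

(* Main.v *)
Require Import Defs.
From HB Require Import structures.
From mathcomp Require Import all_boot all_order all_algebra.
From mathcomp Require Import all_classical all_reals all_analysis.
From mathcomp Require Import ring lra.

Import Order.TTheory GRing.Theory Num.Theory.
Import numFieldNormedType.Exports.

Local Open Scope ring_scope.

(** Write L = H0 + H1 F with F = f x - fstar.  Integrating the gradient bound
    along a segment of length at most 1 / sqrt H1 gives the usual quadratic
    upper bound on f with curvature L ([smooth_descent]).  Comparing that bound
    with the minimum of f controls the gradient by the function gap
    ([smooth_sqr_gradient_le]), and this makes the warm-up step short enough
    for the quadratic bound to hold along it, while keeping eta L <= 1.  A step
    therefore lowers f by at least eta |grad f|^2 / 2, hence by eta mu F under
    the Polyak-Lojasiewicz inequality ([gradient_step_decrease]).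

    For the complexity, theta <= eta (H0 + 3 H1 F), so F drops at least as fast
    as in dF/dk = - theta mu F / (H0 + 3 H1 F).  Along this flow the function
    H0 ln F + 3 H1 F decreases at the constant rate theta mu, and it does so
    along the discrete iteration as well because ln is concave
    ([potential_decrease]).  This single potential covers both the regime where
    H1 F dominates and the linearly convergent one.  If F N > eps, summing N
    steps gives N theta mu < H0 ln (F 0 / eps) + 3 H1 F 0, so C = 3 works. *)

(** * Euclidean geometry of row vectors *)

Definition dot {R : realType} {d : nat} (u v : 'rV[R]_d) : R :=
  \sum_(i < d) u 0 i * v 0 i.

Lemma enorm_ge0 (R : realType) (d : nat) (v : 'rV[R]_d) : 0 <= enorm v.
Proof. exact: sqrtr_ge0. Qed.

Lemma sqr_enorm (R : realType) (d : nat) (v : 'rV[R]_d) :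
  enorm v ^+ 2 = dot v v.
Proof.
rewrite sqr_sqrtr; last by apply: sumr_ge0 => i _; exact: sqr_ge0.
by apply: eq_bigr => i _; rewrite expr2.
Qed.

Lemma enormZ (R : realType) (d : nat) (a : R) (v : 'rV[R]_d) :
  0 <= a -> enorm (a *: v) = a * enorm v.
Proof.
move=> a0; apply/eqP; rewrite -(@eqrXn2 _ 2) ?enorm_ge0 ?mulr_ge0 ?enorm_ge0//.
rewrite exprMn !sqr_enorm /dot mulr_sumr; apply/eqP/eq_bigr => i _.
by rewrite !mxE; ring.
Qed.

Lemma dotBl (R : realType) (d : nat) (u v w : 'rV[R]_d) :
  dot (u - v) w = dot u w - dot v w.
Proof.
by rewrite /dot -sumrB; apply: eq_bigr => i _; rewrite !mxE; ring.
Qed.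

Lemma dotZr (R : realType) (d : nat) (a : R) (u v : 'rV[R]_d) :
  dot u (a *: v) = a * dot u v.
Proof.
by rewrite /dot mulr_sumr; apply: eq_bigr => i _; rewrite !mxE; ring.
Qed.

(** The form of Cauchy-Schwarz used below: expanding |u - c v|^2 >= 0 gives it
    without a case distinction on vanishing vectors. *)
Lemma dot_le_of_enorm_le (R : realType) (d : nat) (c : R) (u v : 'rV[R]_d) :
  0 < c -> enorm u <= c * enorm v -> dot u v <= c * enorm v ^+ 2.
Proof.
move=> c0 uv.
have usq : dot u u <= c ^+ 2 * dot v v.
  by rewrite -!sqr_enorm -exprMn ler_sqr ?nnegrE ?mulr_ge0 ?enorm_ge0 ?(ltW c0).
have sq : 0 <= dot u u - 2 * c * dot u v + c ^+ 2 * dot v v.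
  rewrite /dot !mulr_sumr -sumrB -big_split /=; apply: sumr_ge0 => i _.
  have -> : u 0 i * u 0 i - 2 * c * (u 0 i * v 0 i)
            + c ^+ 2 * (v 0 i * v 0 i) = (u 0 i - c * v 0 i) ^+ 2 by ring.
  exact: sqr_ge0.
rewrite sqr_enorm -(ler_pM2l c0); lra.
Qed.

(** * The quadratic upper bound *)

Lemma derive_dot_gradient (R : realType) (d : nat) (f : 'rV[R]_d -> R)
    (x v : 'rV[R]_d) :
  differentiable f x -> 'D_v f x = dot (gradient f x) v.
Proof.
move=> df; rewrite deriveE// {1}(row_sum_delta v) linear_sum.
by apply: eq_bigr => i _; rewrite linearZ/= mxE deriveE// mulrC.
Qed.

(** The difference quotients of s |-> f (x + s v) at t are those defining the
    derivative of f at x + t v in the direction v. *)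
Lemma is_derive_line (R : realType) (d : nat) (f : 'rV[R]_d -> R)
    (x v : 'rV[R]_d) (t : R) :
  differentiable f (x + t *: v) ->
  is_derive t 1 (fun s : R => f (x + s *: v)) (dot (gradient f (x + t *: v)) v).
Proof.
move=> df; have dfv : derivable f (x + t *: v) v by exact: diff_derivable.
have quotE : (fun h : R => h^-1 *: (((fun s : R => f (x + s *: v))
      \o shift t) (h *: (1 : R)) - f (x + t *: v))) =
    (fun h : R => h^-1 *: ((f \o shift (x + t *: v)) (h *: v)
      - f (x + t *: v))).
  apply/funext => h /=; congr (_ *: (f _ - _)).
  have -> : h *: (1 : R) = h by exact: mulr1.
  by rewrite scalerDl addrCA.
apply: DeriveDef; first by rewrite /derivable quotE.
by rewrite -derive_dot_gradient// /derive quotE.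
Qed.

Lemma is_derive_quadratic (R : realType) (a c t : R) :
  is_derive t 1 (fun s : R => a * s + c * s ^+ 2) (a + c * (2 * t)).
Proof.
have -> : (fun s : R => a * s + c * s ^+ 2) =
  a \*: (id : R -> R) + c \*: (id : R -> R) ^+ 2 by apply/funext.
by apply: is_derive_eq; rewrite /GRing.scale/= !mulr1 expr1.
Qed.

(** The mean value theorem replaces the integral of the gradient: the function
    psi, the excess of f over its quadratic model along the segment, has a
    nonpositive derivative at every point of ]0, 1[. *)
Lemma smooth_descent (R : realType) (d : nat) (f : 'rV[R]_d -> R)
    (fstar H0 H1 : R) (x v : 'rV[R]_d) :
  (forall z, differentiable f z) -> smooth f fstar H0 H1 ->
  0 < H0 + H1 * (f x - fstar) -> enorm v <= 1 / Num.sqrt H1 ->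
  f (x + v) <= f x + dot (gradient f x) v
    + (H0 + H1 * (f x - fstar)) / 2 * enorm v ^+ 2.
Proof.
move=> df sf; set L := H0 + _ => L0 vle.
set a := dot (gradient f x) v; set c := L / 2 * enorm v ^+ 2.
pose psi (t : R) := f (x + t *: v) - (a * t + c * t ^+ 2).
pose dpsi (t : R) := dot (gradient f (x + t *: v)) v - (a + c * (2 * t)).
have dpsiP (t : R) : is_derive t 1 psi (dpsi t).
  apply: is_deriveB; first exact: is_derive_line.
  exact: is_derive_quadratic.
have [|t t01 psiE] := @MVT R psi dpsi 0 1 ltr01 (fun t _ => dpsiP t).
  apply: derivable_within_continuous => t _.
  by have [] := dpsiP t.
have {t01} [t0 t1] : 0 < t /\ t < 1 by move: t01; rewrite in_itv/= => /andP[].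
have dpsi_le0 : dpsi t <= 0.
  have tv : enorm (x + t *: v - x) = t * enorm v.
    by rewrite addrAC subrr add0r enormZ ?ltW.
  have : dot (gradient f (x + t *: v) - gradient f x) v
         <= L * t * enorm v ^+ 2.
    apply: dot_le_of_enorm_le; first exact: mulr_gt0.
    rewrite -mulrA -tv; apply: sf; rewrite tv.
    apply: le_trans vle; rewrite ler_piMl ?enorm_ge0 ?ltW//.
  by rewrite dotBl -/a /dpsi /c; lra.
move: psiE dpsi_le0; rewrite /psi scale1r scale0r addr0; lra.
Qed.

Lemma smooth_gradient_step (R : realType) (d : nat) (f : 'rV[R]_d -> R)
    (fstar H0 H1 t : R) (x : 'rV[R]_d) :
  (forall z, differentiable f z) -> smooth f fstar H0 H1 ->
  0 < H0 + H1 * (f x - fstar) -> 0 <= t ->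
  t * enorm (gradient f x) <= 1 / Num.sqrt H1 ->
  f (x - t *: gradient f x) <= f x
    - t * (1 - t * (H0 + H1 * (f x - fstar)) / 2) * enorm (gradient f x) ^+ 2.
Proof.
move=> df sf L0 t0 tle; set g := gradient f x.
have normN : enorm (- (t *: g)) = t * enorm g.
  by rewrite -enormZ// /enorm; congr Num.sqrt; apply: eq_bigr => i _;
    rewrite !mxE sqrrN.
have := smooth_descent R d f fstar H0 H1 x (- (t *: g)) df sf L0.
rewrite normN => /(_ tle); rewrite -scaleNr dotZr -sqr_enorm -/g; lra.
Qed.

(** A gradient step cannot go below fstar.  The step 1 / L, best for the
    quadratic bound, gives |grad f|^2 <= 2 L F when its length is admissible;
    otherwise the longest admissible step is shorter than 1 / L and gives
    sqrt H1 |grad f| <= 2 H1 F.  The stated bound is a common weakening. *)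
Lemma smooth_sqr_gradient_le (R : realType) (d : nat) (f : 'rV[R]_d -> R)
    (fstar H0 H1 : R) (x : 'rV[R]_d) :
  0 < H0 -> 0 < H1 -> (forall z, differentiable f z) -> is_min f fstar ->
  smooth f fstar H0 H1 ->
  enorm (gradient f x) ^+ 2
    <= 2 * (f x - fstar) * (H0 + 2 * H1 * (f x - fstar)).
Proof.
move=> H0p H1p df [_ fmin] sf.
have F0 : 0 <= f x - fstar by rewrite subr_ge0.
have L0 : 0 < H0 + H1 * (f x - fstar) by rewrite ltr_pwDl// mulr_ge0// ltW.
have := fun t => smooth_gradient_step R d f fstar H0 H1 t x df sf L0.
move: (enorm_ge0 R d (gradient f x)) (fun t => fmin (x - t *: gradient f x)).
set n := enorm _; set F := f x - fstar in F0 L0 *; set L := H0 + _ in L0 *.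
move=> n0 lb step; set r := Num.sqrt H1 in step.
have r0 : 0 < r by rewrite sqrtr_gt0.
have rr : r ^+ 2 = H1 by rewrite sqr_sqrtr ?ltW.
have F_ge t : 0 <= t -> t * n <= 1 / r -> t * L <= 1 -> t * n ^+ 2 <= 2 * F.
  move=> t0 tn tL.
  have : 0 <= t * n ^+ 2 * (1 - t * L).
    by apply: mulr_ge0; [rewrite mulr_ge0 ?sqr_ge0 | rewrite subr_ge0].
  have := step t t0 tn; have := lb t; rewrite /F; lra.
have HFF : 0 <= H1 * F * F by rewrite !mulr_ge0 ?(ltW H1p).
(* The step 1 / L is admissible exactly when n / L <= 1 / r. *)
have [rn|Lrn] := lerP (r * n) L.
  have : L^-1 * n ^+ 2 <= 2 * F.
    apply: F_ge; first by rewrite invr_ge0 ltW.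
      by rewrite ler_pdivlMr// -mulrA ler_pdivrMl// mulr1 mulrC.
    by rewrite mulVf ?gt_eqF.
  by rewrite ler_pdivrMl// /L; lra.
(* Here the step is 1 / (r * n), whose length is exactly 1 / r. *)
have n_gt0 : 0 < n by rewrite -(pmulr_rgt0 _ r0) (lt_trans L0).
have rn0 : 0 < r * n by rewrite mulr_gt0.
have : (r * n)^-1 * n ^+ 2 <= 2 * F.
  apply: F_ge; first by rewrite invr_ge0 ltW.
    by rewrite invfM div1r -mulrA mulVf ?gt_eqF// mulr1.
  by rewrite ler_pdivrMl// mulr1 ltW.
rewrite ler_pdivrMl// expr2 -subr_ge0.
have -> : r * n * (2 * F) - n * n = n * (2 * r * F - n) by ring.
rewrite pmulr_rge0// subr_ge0 => nle.
have : n ^+ 2 <= (2 * r * F) ^+ 2.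
  by rewrite ler_sqr// nnegrE !mulr_ge0// ltW.
have -> : (2 * r * F) ^+ 2 = 4 * (H1 * F * F) by rewrite -rr; ring.
have : 0 <= H0 * F by rewrite mulr_ge0// ltW.
rewrite -expr2; lra.
Qed.

(** * One step of gradient descent *)

(** All that the convergence proof needs about the step size.  The last
    inequality holds because the smaller of 1 / a and 1 / b is at least
    1 / (a + b). *)
Lemma warmup_step_bounds (R : realType) (H0 H1 theta F : R) :
  0 < H0 -> 0 < H1 -> 0 < theta -> 0 <= F ->
  let eta := warmup_step H0 H1 theta F in
  [/\ 0 < eta, eta * H0 <= theta, 3 * (eta * (H1 * F)) <= theta
    & theta <= eta * (H0 + 3 * H1 * F)].
Proof.
move=> H0p H1p thp F0; rewrite /warmup_step.
have [->|Fn0] := eqVneq F 0.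
  by rewrite divr_gt0// !mulr0 addr0 divfK ?gt_eqF// lexx ltW.
have Fp : 0 < F by rewrite lt_neqAle eq_sym Fn0.
have HFp : 0 < 3 * H1 * F by rewrite !mulr_gt0.
set m := Num.min _ _.
have m0 : 0 < m by rewrite lt_min !divr_gt0.
have mH0 : m * H0 <= 1 by rewrite -ler_pdivlMr// ge_min lexx.
have mHF : m * (3 * H1 * F) <= 1 by rewrite -ler_pdivlMr// ge_min lexx orbT.
have m_ge : 1 <= m * (H0 + 3 * H1 * F).
  by rewrite /m minEle; case: ifP => _; rewrite mulrDr div1r mulVf ?gt_eqF//;
    [rewrite lerDl|rewrite lerDr]; rewrite mulr_ge0 ?invr_ge0 ?ltW.
split; first exact: mulr_gt0.
- by rewrite -mulrA ler_piMr// ltW.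
- have -> : 3 * (theta * m * (H1 * F)) = theta * (m * (3 * H1 * F)) by ring.
  by rewrite ler_piMr// ltW.
- by rewrite -mulrA ler_peMr// ltW.
Qed.

(** Since theta <= 3/4, the step satisfies eta L <= theta + theta / 3 <= 1, so
    the quadratic bound loses at most half of eta |grad f|^2. *)
Lemma gradient_step_decrease (R : realType) (d : nat) (f : 'rV[R]_d -> R)
    (fstar H0 H1 mu theta : R) (x : 'rV[R]_d) :
  let F := f x - fstar in
  let eta := warmup_step H0 H1 theta F in
  0 < H0 -> 0 < H1 -> (forall z, differentiable f z) -> is_min f fstar ->
  smooth f fstar H0 H1 -> polyak_lojasiewicz f fstar mu ->
  0 < theta <= 3 / 4 ->
  f (x - eta *: gradient f x) - fstar <= F - eta * mu * F.
Proof.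
move=> F eta H0p H1p df fmin sf pl /andP[thp th34].
have F0 : 0 <= F by rewrite subr_ge0; case: fmin.
have := pl x; have := smooth_sqr_gradient_le R d f fstar H0 H1 x H0p H1p df fmin sf.
have [eta0 etaH0 etaHF _] := warmup_step_bounds R H0 H1 theta F H0p H1p thp F0.
rewrite -/eta in eta0 etaH0 etaHF.
have := smooth_gradient_step R d f fstar H0 H1 eta x df sf.
rewrite -/F; move: (enorm_ge0 R d (gradient f x)); set n := enorm _.
move=> n0 step nle pln.
(* With a = eta H0 <= 3/4 and s = eta H1 F <= 1/4, the gradient bound yields
   H1 (eta n)^2 <= 2 (a + 2 s) s <= 5/8. *)
have s0 : 0 <= eta * (H1 * F) by rewrite !mulr_ge0// ltW.
have etan : eta * n <= 1 / Num.sqrt H1.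
  have r0 : 0 < Num.sqrt H1 by rewrite sqrtr_gt0.
  rewrite ler_pdivlMr// -(@ler_pXn2r _ 2)// ?nnegrE ?mulr_ge0 ?(ltW eta0) ?(ltW r0)//.
  rewrite expr1n !exprMn (sqr_sqrtr (ltW H1p)).
  have : eta ^+ 2 * H1 * n ^+ 2 <=
         2 * (eta * H0 + 2 * (eta * (H1 * F))) * (eta * (H1 * F)).
    apply: le_trans (ler_wpM2l _ nle) _; first exact: mulr_ge0 (sqr_ge0 _) (ltW H1p).
    by rewrite le_eqVlt; apply/orP; left; apply/eqP; ring.
  have a0 : 0 <= eta * H0 by rewrite mulr_ge0// ltW.
  have : (eta * H0 + 2 * (eta * (H1 * F))) * (eta * (H1 * F)) <= 5 / 4 * (1 / 4).
    by apply: ler_pM => //; lra.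
  lra.
have L0 : 0 < H0 + H1 * F by rewrite ltr_pwDl// mulr_ge0// ltW.
have etaL : eta * (H0 + H1 * F) <= 1 by rewrite mulrDr; lra.
have : 0 <= eta * n ^+ 2 * (1 - eta * (H0 + H1 * F)).
  by rewrite !mulr_ge0 ?sqr_ge0 ?subr_ge0// ltW.
have := step L0 (ltW eta0) etan.
have := ler_wpM2l (ltW eta0) pln.
rewrite /F; lra.
Qed.

(** * The potential and the iteration count *)

(** Concavity of ln gives ln G - ln F <= (G - F) / F, so the potential changes
    by at most (G - F) (H0 + 3 H1 F) / F <= - mu eta (H0 + 3 H1 F). *)
Lemma potential_decrease (R : realType) (H0 H1 mu theta eta F G : R) :
  0 < H0 -> 0 < H1 -> 0 < mu -> 0 < F -> 0 < G ->
  theta <= eta * (H0 + 3 * H1 * F) -> G <= F - eta * mu * F ->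
  H0 * ln G + 3 * H1 * G + theta * mu <= H0 * ln F + 3 * H1 * F.
Proof.
move=> H0p H1p mup Fp Gp thle GF.
have lnG : ln G - ln F <= (G - F) / F.
  rewrite -ln_div ?posrE// mulrBl divff ?gt_eqF//.
  rewrite -[X in ln X](addrNK 1) addrC; apply: le_ln1Dx.
  by rewrite ltrBrDl subrr divr_gt0.
have GFF : (G - F) / F <= - (eta * mu) by rewrite ler_pdivrMr//; lra.
have := ler_wpM2l (ltW H0p) (le_trans lnG GFF).
have := ler_wpM2l (ltW H1p) GF.
have := ler_wpM2l (ltW mup) thle; lra.
Qed.

(** Positivity is only required at the last index: since F is nonincreasing,
    it propagates to all earlier ones. *)
Lemma potential_after_steps (R : realType) (H0 H1 mu theta : R)
    (F eta : nat -> R) :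
  0 < H0 -> 0 < H1 -> 0 < mu -> (forall k, 0 <= F k) ->
  (forall k, 0 <= eta k) ->
  (forall k, theta <= eta k * (H0 + 3 * H1 * F k)) ->
  (forall k, F k.+1 <= F k - eta k * mu * F k) ->
  forall N, 0 < F N ->
  H0 * ln (F N) + 3 * H1 * F N + N%:R * (theta * mu)
    <= H0 * ln (F 0%N) + 3 * H1 * F 0%N.
Proof.
move=> H0p H1p mup F0 eta0 thle dec; elim=> [|k IH] Fk1; first by rewrite mul0r addr0.
have Fk : 0 < F k.
  apply: lt_le_trans Fk1 (le_trans (dec k) _).
  by rewrite gerBl !mulr_ge0// ltW.
have := potential_decrease R _ _ _ _ _ _ _ H0p H1p mup Fk Fk1 (thle k) (dec k).
have := IH Fk; rewrite -natr1; lra.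
Qed.

Theorem mainTheorem12 (R : realType) :
  exists C : R, 0 < C /\
    forall (d : nat) (H0 H1 mu : R) (f : 'rV[R]_d -> R) (fstar : R)
           (theta : R) (x : nat -> 'rV[R]_d),
      let F := fun k : nat => f (x k) - fstar in
      let eta := fun k : nat => warmup_step H0 H1 theta (F k) in
      0 < H0 -> 0 < H1 -> 0 < mu ->
      (forall z : 'rV[R]_d, differentiable f z) ->
      is_min f fstar ->
      smooth f fstar H0 H1 ->
      polyak_lojasiewicz f fstar mu ->
      0 < theta <= 3 / 4 ->
      gradient_descent f eta x ->
      (forall k : nat, F k.+1 <= F k - eta k * mu * F k) /\
      (forall (eps : R) (N : nat),
         0 < eps < F 0%N ->
         C * (H0 / (theta * mu) * ln (F 0%N / eps)
              + H1 * F 0%N / (theta * mu)) <= N%:R ->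
         f (x N) - fstar <= eps).
Proof.
exists 3; split => // d H0 H1 mu f fstar theta x F eta H0p H1p mup df fmin sf pl
  thP gd.
have thp : 0 < theta by case/andP: thP.
have F0 k : 0 <= F k by rewrite subr_ge0; case: fmin.
have dec k : F k.+1 <= F k - eta k * mu * F k.
  by rewrite /F gd; apply: gradient_step_decrease.
split=> // eps N /andP[eps0 epsF] NC; rewrite -/(F N) leNgt; apply/negP => epsN.
have FN : 0 < F N by exact: lt_trans epsN.
have etaP k := warmup_step_bounds R H0 H1 theta (F k) H0p H1p thp (F0 k).
have eta0 k : 0 <= eta k by apply: ltW; case: (etaP k).
have thle k : theta <= eta k * (H0 + 3 * H1 * F k) by case: (etaP k).
have := potential_after_steps R _ _ _ _ F eta H0p H1p mup F0 eta0 thle dec N FN.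
have thmu : 0 < theta * mu by rewrite mulr_gt0.
have {NC} : 3 * (H0 * ln (F 0%N / eps) + H1 * F 0%N) <= N%:R * (theta * mu).
  by rewrite -ler_pdivrMr//; congr (_ <= _): NC; ring.
have Fp : 0 < F 0%N by exact: lt_trans epsF.
have : 0 <= H0 * ln (F 0%N / eps).
  by rewrite mulr_ge0 ?(ltW H0p)// ln_ge0// ler_pdivlMr// mul1r ltW.
rewrite ln_div ?posrE//.
have : H0 * ln eps <= H0 * ln (F N).
  by rewrite ler_pM2l// ler_ln ?posrE// ltW.
have : 0 < H1 * F N by rewrite mulr_gt0.
lra.
Qed.
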